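(* Let $Y$ be a real Banach space whose dual $Y^*$ is isometrically isomorphic to $\ell_1$, let $\{e_n^*\}_{n=1}^\infty$ denote the standard basis of $Y^*=\ell_1$, and let $X$ be a closed subspace of $Y$. Then there exists a function $k:\operatorname{ext} B_{X^*}\to\mathbb N$ such that for every $f^*\in\operatorname{ext} B_{X^*}$, $$f^*=\delta(f^* )\,e^*_{k(f^* )}\big|_X,$$ where $\delta(f^* )$ is a real number with $|\delta(f^* )|=1$ for every $f^*\in\operatorname{ext}B_{X^*}$.
   Context: All spaces are real. $B_{X^*}$ is the closed unit ball of $X^*$ and $\operatorname{ext}B_{X^*}$ is its set of extreme points. The standard basis of $Y^*$ is the sequence corresponding, under a fixed isometric identification $Y^*=\ell_1$, to the unit vector basis of $\ell_1$. *)

(* Defs.v *)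
From HB Require Import structures.
From mathcomp Require Import all_boot all_order all_algebra.
From mathcomp Require Import all_classical all_reals all_analysis.

Set Implicit Arguments.
Unset Strict Implicit.
Unset Printing Implicit Defensive.

Import Order.TTheory GRing.Theory Num.Theory.
Import numFieldNormedType.Exports.

Local Open Scope classical_set_scope.
Local Open Scope ring_scope.

Section ClosedSubspace.
Context {R : realType} {V : normedModType R}.

Record subspace_of (S : submodClosed V) := SubspaceOf {
  subspace_val :> V;
  subspace_valP : subspace_val \in S
}.

Variable S : submodClosed V.

HB.instance Definition _ := [isSub for @subspace_val S].
HB.instance Definition _ := [Choice of subspace_of S by <:].
HB.instance Definition _ := [SubChoice_isSubLmodule of subspace_of S by <:].

Let subspace_norm (x : subspace_of S) : R := `|val x|.

Let subspace_normD x y :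
  subspace_norm (x + y) <= subspace_norm x + subspace_norm y.
Proof. exact: ler_normD. Qed.

Let subspace_normZ (a : R) x : subspace_norm (a *: x) = `|a| * subspace_norm x.
Proof. exact: normrZ. Qed.

Let subspace_norm0_eq0 x : subspace_norm x = 0 -> x = 0.
Proof. by move=> /normr0_eq0 x0; apply: val_inj. Qed.

HB.instance Definition _ := Lmodule_isNormed.Build R (subspace_of S)
  subspace_normD subspace_normZ subspace_norm0_eq0.

Lemma subspace_normE (x : subspace_of S) : `|x| = `|val x|.
Proof. by []. Qed.

Lemma subspace_val_continuous : continuous (val : subspace_of S -> V).
Proof.
apply: bounded_linear_continuous; apply/linear_boundedP.
by exists 1; split=> // r r1 x; rewrite -[leLHS]mul1r ler_wpM2r// ltW.
Qed.

End ClosedSubspace.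

Section Dual.
Context {R : realType} (V : normedModType R).

Definition dual_pred : {pred V -> R^o} :=
  mem [set f : V -> R^o | linear f /\ continuous f].

Record dual := Dual {
  dual_val :> V -> R^o;
  dual_valP : dual_val \in dual_pred
}.

HB.instance Definition _ := [isSub for dual_val].
HB.instance Definition _ := [Choice of dual by <:].

Lemma dual_submod_closed : submod_closed dual_pred.
Proof.
split.
  rewrite inE /=; split; first by move=> a u v; rewrite scaler0 addr0.
  exact: cst_continuous.
move=> a f g; rewrite !inE /= => -[lf cf] [lg cg]; split.
  move=> b u v; rewrite !fctE lf lg !scalerDr !scalerA (mulrC a b).
  by rewrite addrACA.
move=> x; apply: cvgD; last exact: cg.
by apply: cvgZr; exact: cf.
Qed.

HB.instance Definition _ := GRing.isSubmodClosed.Build R (V -> R^o) dual_pred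
  dual_submod_closed.
HB.instance Definition _ := [SubChoice_isSubLmodule of dual by <:].

Lemma dual_linear (f : dual) : linear f.
Proof. by case: f => f /=; rewrite inE => -[]. Qed.

Lemma dual_continuous (f : dual) : continuous f.
Proof. by case: f => f /=; rewrite inE => -[]. Qed.

HB.instance Definition _ (f : dual) :=
  GRing.isLinear.Build R V R^o *:%R f (dual_linear f).

Definition dual_norm (f : dual) : R :=
  sup [set `|f x| | x in [set x : V | `|x| <= 1]].

Lemma dual_has_sup (f : dual) :
  has_sup [set `|f x| | x in [set x : V | `|x| <= 1]].
Proof.
split; first by exists `|f 0|, 0 => //=; rewrite normr0.
have : bounded_near f (nbhs (0 : V)).
  exact/continuous_linear_bounded/dual_continuous.
move=> /bounded_funP /(_ 1) [M fM]; exists M => _ [x x1 <-]; exact: fM.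
Qed.

Lemma dual_norm_ub (f : dual) (x : V) : `|x| <= 1 -> `|f x| <= dual_norm f.
Proof.
by move=> x1; apply: ub_le_sup; [exact: (dual_has_sup f).2|exists x].
Qed.

Lemma dual_norm_le (f : dual) (M : R) :
  (forall x : V, `|x| <= 1 -> `|f x| <= M) -> dual_norm f <= M.
Proof.
move=> fM; apply: ge_sup; first exact: (dual_has_sup f).1.
by move=> _ [x x1 <-]; exact: fM.
Qed.

Let dual_normD f g : dual_norm (f + g) <= dual_norm f + dual_norm g.
Proof.
apply: dual_norm_le => x x1.
by rewrite (le_trans (ler_normD _ _))// lerD// dual_norm_ub.
Qed.

Let dual_normZ_le (a : R) f : dual_norm (a *: f) <= `|a| * dual_norm f.
Proof.
apply: dual_norm_le => x x1.
by rewrite [leLHS]normrM ler_wpM2l// dual_norm_ub.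
Qed.

Let dual_normZ (a : R) f : dual_norm (a *: f) = `|a| * dual_norm f.
Proof.
apply/eqP; rewrite eq_le dual_normZ_le /=.
have [->|a0] := eqVneq a 0.
  rewrite normr0 mul0r.
  by rewrite (le_trans (normr_ge0 _) (@dual_norm_ub _ 0 _))// normr0.
rewrite -ler_pdivlMl ?normr_gt0// -normfV.
by rewrite -{1}[f](scalerK a0); exact: dual_normZ_le.
Qed.

Let dual_norm0_eq0 f : dual_norm f = 0 -> f = 0.
Proof.
move=> f0; apply: val_inj; apply/funext => x /=.
have [->|x0] := eqVneq x 0; first by rewrite linear0.
have nx : `|x| != 0 by rewrite normr_eq0.
have : `|f (`|x|^-1 *: x)| <= 0.
  by rewrite -f0 dual_norm_ub// normrZ normfV normr_id mulVf.
by rewrite normr_le0 linearZ/= scaler_eq0 invr_eq0 (negPf nx) => /eqP.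
Qed.

HB.instance Definition _ := Lmodule_isNormed.Build R dual
  dual_normD dual_normZ dual_norm0_eq0.

Lemma dual_normE (f : dual) : `|f| = dual_norm f.
Proof. by []. Qed.

End Dual.

Definition dual_unit_ball {R : realType} (V : normedModType R) : set (dual V) :=
  closed_ball 0 1.
Arguments dual_unit_ball {R} V _.

Section Restriction.
Context {R : realType} {V : normedModType R} (S : submodClosed V).

Lemma dual_restr_subproof (f : dual V) :
  (f \o @subspace_val R V S) \in @dual_pred R (subspace_of S).
Proof.
rewrite inE /=; split; first by move=> a x y; rewrite /= -(dual_linear f).
move=> x; apply: continuous_comp; first exact: subspace_val_continuous.
exact: dual_continuous.
Qed.

Definition dual_restr (f : dual V) : dual (subspace_of S) :=
  Dual (dual_restr_subproof f).

End Restriction.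

Section Ell1.
Context (R : realType).

Definition ell1_pred : {pred nat -> R^o} :=
  mem [set u : nat -> R^o | cvgn [normed series u]].

Record ell1 := Ell1 {
  ell1_val :> nat -> R^o;
  ell1_valP : ell1_val \in ell1_pred
}.

HB.instance Definition _ := [isSub for ell1_val].
HB.instance Definition _ := [Choice of ell1 by <:].

Lemma ell1_submod_closed : submod_closed ell1_pred.
Proof.
split.
  rewrite inE /=; have -> : [normed series (0 : nat -> R^o)] = cst 0.
    by apply/funext => n /=; apply: big1 => i _; rewrite normr0.
  exact: is_cvg_cst.
move=> a u v; rewrite !inE /= => cu cv.
apply: (@series_le_cvg _ _ (fun n => `|a| * `|u n| + `|v n|)) => //.
- by move=> n; exact: normr_ge0.
- by move=> n; rewrite (le_trans (ler_normD _ _))// [X in X + _]normrM.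
- have cu' : cvgn (series (fun n => `|u n| : R)) by exact: cu.
  have cv' : cvgn (series (fun n => `|v n| : R)) by exact: cv.
  exact: (is_cvg_seriesD (@is_cvg_seriesZ _ _ `|a| cu') cv').
Qed.

HB.instance Definition _ := GRing.isSubmodClosed.Build R (nat -> R^o) ell1_pred
  ell1_submod_closed.
HB.instance Definition _ := [SubChoice_isSubLmodule of ell1 by <:].

Lemma ell1_cvg (u : ell1) : cvgn [normed series u].
Proof. by case: u => u /=; rewrite inE. Qed.

Definition ell1_norm (u : ell1) : R := limn [normed series u].

Lemma ell1_norm_ge (u : ell1) n : [normed series u] n <= ell1_norm u.
Proof.
have ndu : nondecreasing_seq (series (fun n => `|u n| : R)).
  by apply: nondecreasing_series => k _ _; exact: normr_ge0.
have cu : cvgn (series (fun n => `|u n| : R)) by exact: ell1_cvg.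
exact: (nondecreasing_cvgn_le ndu cu n).
Qed.

Let ell1_normD u v : ell1_norm (u + v) <= ell1_norm u + ell1_norm v.
Proof.
have := lim_seriesD (@ell1_cvg u) (@ell1_cvg v); rewrite /ell1_norm => <-.
apply: lim_series_le; first exact: ell1_cvg.
  exact: is_cvg_seriesD (@ell1_cvg u) (@ell1_cvg v).
by move=> n; exact: ler_normD.
Qed.

Let ell1_normZ (a : R) u : ell1_norm (a *: u) = `|a| * ell1_norm u.
Proof.
have <- : limn (series (`|a| *: (fun n => `|u n| : R))) = `|a| * ell1_norm u.
  exact: (@lim_seriesZ _ _ `|a| (@ell1_cvg u)).
by congr (limn _); apply/funext => n /=; apply: eq_bigr => i _; rewrite normrM.
Qed.

Let ell1_norm0_eq0 u : ell1_norm u = 0 -> u = 0.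
Proof.
move=> u0; apply: val_inj; apply/funext => n /=.
apply/eqP; rewrite -normr_le0 -u0; apply: le_trans (ell1_norm_ge u n.+1).
by rewrite /normed_series_of seriesSr /= lerDr sumr_ge0.
Qed.

HB.instance Definition _ := Lmodule_isNormed.Build R ell1
  ell1_normD ell1_normZ ell1_norm0_eq0.

Lemma ell1_normE (u : ell1) : `|u| = limn [normed series u].
Proof. by []. Qed.

(* The standard basis e_1, e_2, ... is indexed from 0: ell1_basis n is e_(n+1). *)
Lemma ell1_basis_subproof (n : nat) :
  (fun i => (i == n)%:R : R^o) \in ell1_pred.
Proof.
rewrite inE /=; apply: nondecreasing_is_cvgn.
  by apply: nondecreasing_series => k _ _; exact: normr_ge0.
exists 1 => _ [m _ <-]; rewrite /normed_series_of seriesEnat /=.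
rewrite (eq_bigr (fun i => if i == n then 1 else 0)); last first.
  by move=> i _; case: (i == n); rewrite ?normr1 ?normr0.
by rewrite -big_mkcond big_nat1_eq; case: ifP => // _; exact: ler01.
Qed.

Definition ell1_basis (n : nat) : ell1 := Ell1 (ell1_basis_subproof n).

End Ell1.

Section ExtremePoints.
Context {R : numDomainType} {E : lmodType R}.

Definition extreme_points (A : set E) : set E :=
  [set x | A x /\ forall (y z : E) (t : R), A y -> A z -> 0 < t < 1 ->
    x = t *: y + (1 - t) *: z -> y = x /\ z = x].

End ExtremePoints.

Definition isometric_isomorphism {R : realType} {V W : normedModType R}
    (T : {linear V -> W}) : Prop :=
  bijective T /\ forall x, `|T x| = `|x|.

(* Main.v *)
(* Extend an extreme f by Hahn-Banach to F on Y with |F| <= 1 and write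
   F = \sum_i a_i e_i with \sum_i |a_i| <= 1. If a_n != 0, then f is the convex
   combination of sgn(a_n) e_n|X, with weight |a_n|, and of the normalized
   remainder, so extremality gives f = sgn(a_n) e_n|X. *)
Require Import Defs.
From HB Require Import structures.
From mathcomp Require Import all_boot all_order all_algebra.
From mathcomp Require Import all_classical all_reals all_analysis.
From mathcomp Require Import lra.
Import Order.TTheory GRing.Theory Num.Theory.
Import numFieldNormedType.Exports.
Local Open Scope classical_set_scope.
Local Open Scope ring_scope.

(** * Hahn-Banach extension below a sublinear functional *)

Section HahnBanach.
Variables (R : realType) (V : lmodType R) (p : V -> R).
Hypothesis pD : forall x y, p (x + y) <= p x + p y.
Hypothesis pZ : forall (a : R) x, 0 <= a -> p (a *: x) = a * p x.

(* Linear relations below p; being below p forces such a relation to be the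
   graph of a partial function. *)
Definition dominated_linear (G : set (V * R^o)) : Prop :=
  [/\ G !=set0, forall a g h, G g -> G h -> G (a *: g + h) &
      forall g, G g -> g.2 <= p g.1].

Lemma dominated_linear0 G : dominated_linear G -> G 0.
Proof.
by move=> [[g Gg] GL _]; rewrite -(addNr g) -scaleN1r; exact: GL.
Qed.

Lemma dominated_linearZ G a g : dominated_linear G -> G g -> G (a *: g).
Proof.
move=> Gd Gg; rewrite -[_ *: _]addr0; have [_ GL _] := Gd.
by apply: GL => //; exact: dominated_linear0.
Qed.

(** The difference of two pairs over the same point lies over 0, where [p] vanishes; domination of
    both differences gives the two inequalities. *)
Lemma dominated_linear_fun G g h : dominated_linear G -> G g -> G h ->
  g.1 = h.1 -> g.2 = h.2.
Proof.
move=> Gd; have [_ GL Gp] := Gd.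
have p0 : p 0 = 0 by rewrite -(scale0r (0 : V)) pZ// mul0r.
have le_fun k l : G k -> G l -> k.1 = l.1 -> k.2 <= l.2.
  move=> Gk Gl kl; have /Gp := GL (-1) l k Gl Gk.
  by rewrite /= !scaleN1r kl addNr p0 addrC subr_le0.
by move=> Gg Gh gh; apply/eqP; rewrite eq_le !le_fun.
Qed.

(** The value [c] at [v] has to lie above every [g.2 - p (g.1 - v)] and below every
    [p (h.1 + v) - h.2]. Subadditivity of [p] puts each lower bound below each upper bound, so the
    supremum of the lower bounds serves. *)
Lemma dominated_linear_extend G v : dominated_linear G ->
  exists c : R^o, dominated_linear
    [set h | exists g t, G g /\ h = g + t *: (v, c)].
Proof.
move=> Gd; have [[g0 Gg0] GL Gp] := Gd.
pose A := [set (g.2 : R) - p (g.1 - v) | g in G].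
have Aub h : G h -> ubound A (p (h.1 + v) - h.2).
  move=> Gh _ [g Gg <-].
  have /Gp := GL 1 g h Gg Gh; rewrite scale1r /= => ghp.
  have := pD (g.1 - v) (h.1 + v); rewrite addrACA addNr addr0.
  by move: ghp; lra.
have cge g : G g -> (g.2 : R) - p (g.1 - v) <= sup A.
  by move=> Gg; apply: ub_le_sup; [exists (p (g0.1 + v) - g0.2); exact: Aub|
    exists g].
have cle h : G h -> sup A <= p (h.1 + v) - h.2.
  by move=> Gh; apply: ge_sup (Aub h Gh); exists (g0.2 - p (g0.1 - v)), g0.
exists (sup A); split.
- by exists g0, g0, 0; rewrite scale0r addr0.
- move=> a _ _ [g [t [Gg ->]]] [h [s [Gh ->]]].
  exists (a *: g + h), (a * t + s); split; first exact: GL.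
  by rewrite scalerDr scalerDl scalerA addrACA.
- move=> _ [g [t [Gg ->]]]; suff : (g.2 : R) + t * sup A <= p (g.1 + t *: v) by [].
  (* Homogeneity allows division by the absolute value of [t]: a positive [t] reduces to [cle], a
     negative one to [cge], each at a rescaled [g]. *)
  have [t0|t0|t0] := ltrgt0P t.
  + rewrite -lerBrDl -ler_pdivlMl// mulrBr -pZ ?invr_ge0 ?(ltW t0)//.
    rewrite scalerDr scalerK ?gt_eqF//.
    exact: cle (dominated_linearZ _ t^-1 _ Gd Gg).
  + have s0 : 0 < - t by rewrite oppr_gt0.
    rewrite -lerBrDr -mulNr -lerBlDl -ler_pdivrMl// mulrBr.
    rewrite -pZ ?invr_ge0 ?(ltW s0)// scalerDr.
    rewrite -[t *: v]opprK -scaleNr scalerN scalerK ?gt_eqF//.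
    exact: cge (dominated_linearZ _ (- t)^-1 _ Gd Gg).
  + rewrite t0 mul0r scale0r !addr0; exact: Gp.
Qed.

Lemma dominated_linear_bigcup (F : set (set (V * R^o))) :
  F !=set0 -> F `<=` dominated_linear -> total_on F subset ->
  dominated_linear (\bigcup_(G in F) G).
Proof.
move=> [G0 FG0] Fd Ftot; split.
- by have [[g G0g] _ _] := Fd _ FG0; exists g, G0.
- move=> a g h [G FG Gg] [H FH Hh].
  have [GH|HG] := Ftot _ _ FG FH.
    by exists H => //; have [_ HL _] := Fd _ FH; apply: HL => //; exact: GH.
  by exists G => //; have [_ GL _] := Fd _ FG; apply: GL => //; exact: HG.
- by move=> g [G FG Gg]; have [_ _] := Fd _ FG; exact.
Qed.

Theorem hahn_banach_graph (G0 : set (V * R^o)) : dominated_linear G0 ->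
  exists F : V -> R^o, [/\ linear F, forall x, F x <= p x &
    forall g, G0 g -> F g.1 = g.2].
Proof.
move=> G0d.
(* [set0] belongs to [P] because it is the union of the empty chain. *)
pose P := [set G | G = set0 \/ (G0 `<=` G /\ dominated_linear G)].
have [F FP Ftot|G [PG Gmax]] := @Zorn_bigcup _ P.
  have [F0|F0] := pselect (F `&` [set G | G !=set0] !=set0); last first.
    left; rewrite -subset0 => g [G FG Gg]; apply: F0.
    by exists G; split=> //; exists g.
  (* Empty members add nothing to the union; all others contain [G0] and are dominated. *)
  right; have -> : \bigcup_(G in F) G = \bigcup_(G in F `&` [set G | G !=set0]) G.
    apply/seteqP; split=> g [G].
      by move=> FG Gg; exists G => //; split=> //; exists g.
    by move=> [FG _] Gg; exists G.
  have F'P G : (F `&` [set G | G !=set0]) G -> G0 `<=` G /\ dominated_linear G.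
    by move=> [/FP[->|//] [g]].
  split.
    have [G FG] := F0; have [G0G _] := F'P _ FG.
    by move=> g /G0G Gg; exists G.
  apply: dominated_linear_bigcup => // [G /F'P[]//|G H [FG _] [FH _]].
  exact: Ftot.
(* The maximal [G] is not empty, since [G0] would then be strictly larger. *)
have {PG}[G0G Gd] : G0 `<=` G /\ dominated_linear G.
  case: PG => // GE; exfalso; apply: (Gmax G0); last by right; split.
  rewrite GE; split; first exact: sub0set.
  by move=> G00; exact: (G00 _ (dominated_linear0 _ G0d)).
(* At a point without a value, the one-dimensional extension would contradict maximality. *)
have Gtot x : exists r : R^o, G (x, r).
  have [c Gcd] := dominated_linear_extend _ x Gd.
  apply: contrapT => Gx; apply: (Gmax _ _ (or_intror (conj _ Gcd))).
    split; first by move=> g Gg; exists g, 0; rewrite scale0r addr0.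
    move=> /(_ (x, c)) Gxc; apply: Gx; exists c; apply: Gxc.
    exists 0, 1; rewrite add0r scale1r; split=> //; exact: dominated_linear0.
  by move=> g /G0G Gg; exists g, 0; rewrite scale0r addr0.
have [F GF] := choice Gtot; have [_ GL Gp] := Gd; exists F; split.
- move=> a x y.
  exact: (dominated_linear_fun _ _ _ Gd (GF _) (GL a _ _ (GF x) (GF y)) erefl).
- by move=> x; exact: (Gp _ (GF x)).
- by move=> g /G0G Gg; exact: (dominated_linear_fun _ _ _ Gd (GF _) Gg erefl).
Qed.

End HahnBanach.

Lemma dual_norm_bound (R : realType) (V : normedModType R) (f : dual V)
    (x : V) : `|f x| <= `|f| * `|x|.
Proof.
have [->|x0] := eqVneq x 0; first by rewrite linear0 !normr0 mulr0.
have nx : 0 < `|x| by rewrite normr_gt0.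
have := @dual_norm_ub R V f (`|x|^-1 *: x); rewrite normrZ normfV normr_id.
rewrite mulVf ?gt_eqF// => /(_ (lexx _)).
by rewrite linearZ /= normrM normfV normr_id ler_pdivrMl// mulrC.
Qed.

(** * Norm-preserving extension and restriction of functionals *)

Section HahnBanachDual.
Context {R : realType} {V : normedModType R}.

(** The one-sided bound, applied to [x] and to [- x], bounds the absolute value of [F x], hence
    gives continuity and the norm estimate. *)
Lemma dual_of_le (F : V -> R^o) (M : R) : 0 <= M -> linear F ->
  (forall x, F x <= M * `|x|) -> exists2 F' : dual V, dual_val F' = F & `|F'| <= M.
Proof.
move=> M0 FL FM.
pose HBF := GRing.isLinear.Build R V R^o *:%R F FL.
pose F' : {linear V -> R^o} := HB.pack F HBF.
have nF x : `|F x| <= M * `|x|.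
  rewrite ler_norml FM andbT lerNl -(normrN x).
  by rewrite -[- F x](linearN F'); exact: FM.
have Fc : continuous F.
  apply: (@bounded_linear_continuous _ _ _ F'); apply/linear_boundedP.
  exists M; split; first exact: num_real.
  move=> r Mr x; apply: le_trans (nF x) _.
  by rewrite ler_wpM2r// ltW.
have Fd : F \in @dual_pred R V by rewrite inE.
exists (Dual Fd) => //; apply: dual_norm_le => x x1 /=.
by rewrite (le_trans (nF x))// ler_piMr.
Qed.

(** The graph of [f] is extended below the seminorm sending [x] to the norm of [f] times the norm of
    [x]. *)
Theorem hahn_banach_dual (S : submodClosed V) (f : dual (subspace_of S)) :
  exists2 F : dual V, dual_restr S F = f & `|F| <= `|f|.
Proof.
pose G0 := [set (val x, f x) | x in [set: subspace_of S]] : set (V * R^o).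
have [|||F [FL Fp FG]] := @hahn_banach_graph R V (fun x => `|f| * `|x|) _ _ G0.
- by move=> x y; rewrite -mulrDr ler_wpM2l// ler_normD.
- by move=> a x a0; rewrite normrZ ger0_norm// mulrCA.
- split; first by exists (val (0 : subspace_of S), f 0), 0.
    move=> a _ _ [x _ <-] [y _ <-]; exists (a *: x + y) => //.
    by rewrite dual_linear.
  move=> _ [x _ <-] /=; apply: le_trans (ler_norm _) _.
  exact: dual_norm_bound.
have [F' F'E nF'] := dual_of_le _ _ (normr_ge0 f) FL Fp.
exists F' => //; apply: val_inj; apply/funext => x /=.
by rewrite F'E; apply: (FG (val x, f x)); exists x.
Qed.

Lemma dual_restr_norm (S : submodClosed V) (F : dual V) :
  `|dual_restr S F| <= `|F|.
Proof. by apply: dual_norm_le => x x1; exact: (dual_norm_ub F). Qed.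

Lemma dual_restrP (S : submodClosed V) (a : R) (F G : dual V) :
  dual_restr S (a *: F + G) = a *: dual_restr S F + dual_restr S G.
Proof. exact: val_inj. Qed.

Lemma dual_unit_ballE (f : dual V) : dual_unit_ball V f = (`|f| <= 1).
Proof. by rewrite /dual_unit_ball closed_ballE// /closed_ball_ /= sub0r normrN. Qed.

End HahnBanachDual.

(** * Splitting off one coordinate in [ell1] *)

Section Ell1Coordinates.
Context {R : realType}.

Lemma ell1_split_norm (a : ell1 R) (n : nat) :
  `|a - a n *: ell1_basis R n| <= `|a| - `|a n|.
Proof.
rewrite [leLHS]ell1_normE; apply: limr_le; first exact: ell1_cvg.
(* The partial sum at [m] runs over indices below [m], so coordinate [n] is present from [n.+1]
   on. *)
exists n.+1 => // m /= nm; rewrite lerBrDr.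
apply: le_trans (ell1_norm_ge a m).
rewrite /normed_series_of !seriesEnat /=.
have nI : n \in index_iota 0 m by rewrite mem_index_iota.
rewrite (bigD1_seq n) ?iota_uniq//= [X in _ <= X](bigD1_seq n) ?iota_uniq//=.
rewrite !fctE eqxx [_ *: 1]mulr1 subrr normr0 add0r [X in X <= _]addrC lerD2l.
by rewrite (eq_bigr (fun i => `|a i|)) // => i /negPf ->; rewrite scaler0 subr0.
Qed.

Lemma ell1_basis_norm (n : nat) : `|ell1_basis R n| <= 1.
Proof.
rewrite ell1_normE; apply: limr_le; first exact: ell1_cvg.
apply: nearW => m; rewrite /normed_series_of seriesEnat /=.
rewrite (eq_bigr (fun i => if i == n then 1 else 0)); last first.
  by move=> i _; case: (i == n); rewrite ?normr1 ?normr0.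
by rewrite -big_mkcond big_nat1_eq; case: ifP.
Qed.

End Ell1Coordinates.

(** For [t < 1], [x] is a convex combination of [u] and [w] divided by [1 - t]. Otherwise the bound
    on [w] forces [t = 1] and [w = 0], so no division by zero arises. *)
Lemma extreme_closed_ball_summand (R : realType) (W : normedModType R)
    (x u w : W) (t : R) : extreme_points (closed_ball 0 1) x ->
  0 < t -> `|u| <= 1 -> `|w| <= 1 - t -> x = t *: u + w -> x = u.
Proof.
move=> [_ xext] t0 u1 w1 xE.
have [t1|t1] := ltP t 1; last first.
  have w0 : w = 0.
    by apply/normr0_eq0/eqP; rewrite eq_le normr_ge0 (le_trans w1)// subr_le0.
  have t1' : t = 1.
    by apply/eqP; rewrite eq_le t1 andbT -subr_ge0 (le_trans _ w1).
  by rewrite xE w0 t1' addr0 scale1r.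
have s0 : 0 < 1 - t by rewrite subr_gt0.
have [||||-> //] := xext u ((1 - t)^-1 *: w) t.
- by rewrite closed_ballE// /closed_ball_ /= sub0r normrN.
- rewrite closed_ballE// /closed_ball_ /= sub0r normrN normrZ.
  by rewrite gtr0_norm ?invr_gt0// ler_pdivrMl// mulr1.
- by rewrite t0.
- by rewrite scalerA mulfV ?gt_eqF// scale1r.
Qed.

Theorem lemma3p1 (R : realType) (Y : completeNormedModType R)
    (T : {linear ell1 R -> dual Y}) (hT : isometric_isomorphism T)
    (X : submodClosed Y) (hX : closed [set` X]) :
  exists (k : extreme_points (dual_unit_ball (subspace_of X)) -> nat)
         (delta : extreme_points (dual_unit_ball (subspace_of X)) -> R),
  forall f : extreme_points (dual_unit_ball (subspace_of X)),
    `|delta f| = 1 /\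
    val f = delta f *: dual_restr X (T (ell1_basis R (k f))).
Proof.
have basis1 n : `|dual_restr X (T (ell1_basis R n))| <= 1.
  by rewrite (le_trans (dual_restr_norm _ _))// hT.2 ell1_basis_norm.
suff /choice[kd kdP] : forall f : extreme_points (dual_unit_ball (subspace_of X)),
    exists kd : nat * R, `|kd.2| = 1 /\
      val f = kd.2 *: dual_restr X (T (ell1_basis R kd.1)).
  by exists (fst \o kd), (snd \o kd).
move=> f; have := set_valP f; move: (val f) => {}f fext.
have [F FE Ff] := hahn_banach_dual X f.
have f1 : `|f| <= 1 by have [+ _] := fext; rewrite dual_unit_ballE.
have [T' _ TK] := hT.1; pose a := T' F.
have Ta : T a = F by exact: TK.
have a1 : `|a| <= 1 by rewrite -hT.2 Ta (le_trans Ff).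
have [[n an0]|a0] := pselect (exists n, a n != 0).
  exists (n, Num.sg (a n)); rewrite normr_sg an0; split=> //=.
  apply: (@extreme_closed_ball_summand _ _ _ _
    (dual_restr X (T (a - a n *: ell1_basis R n))) `|a n| fext).
  - by rewrite normr_gt0.
  - by rewrite normrZ normr_sg an0 mul1r.
  (* Restriction does not increase norms and [T] preserves them, so the bound comes from the
     remainder in [ell1]. *)
  - rewrite (le_trans (dual_restr_norm _ _))// hT.2.
    by rewrite (le_trans (ell1_split_norm _ _))// lerD2r.
  - rewrite scalerA mulrC -numEsg -dual_restrP -FE -Ta.
    by rewrite -linearP addrC subrK.
(* If F = 0 then 0 is extreme, which forces the whole ball to be {0}. *)
have {a0}f0 : f = 0.
  have a0' : a = 0.
    apply: val_inj; apply/funext => n /=.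
    by apply: contrapT => /eqP an0; apply: a0; exists n.
  by rewrite -FE -Ta a0' linear0; exact: val_inj.
(* Any index and sign would do: 0 is the midpoint of [u] and [- u], both in the ball, so extremality
   gives [u = f]. *)
exists (0%N, 1); rewrite normr1 scale1r; split=> //=.
pose u := dual_restr X (T (ell1_basis R 0)).
have [||||<- //] := fext.2 u (- u) 2^-1.
- by rewrite dual_unit_ballE; exact: basis1.
- by rewrite dual_unit_ballE normrN; exact: basis1.
- by lra.
- by rewrite f0 (_ : 1 - 2^-1 = 2^-1 :> R) ?scalerN ?subrr//; lra.
Qed.
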